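(* Let $k,\ell$ be positive integers, let $t\ge2$ be an integer and $c>0$ a real number, and let $\theta$ be the second largest eigenvalue of the matrix $B(k,\ell,2t+1,c)$. Then every finite $(k,\ell)$-semiregular bipartite graph whose adjacency matrix has second largest eigenvalue at most $\theta$ has at most $$\ell\sum_{i=0}^{t-2}(\ell-1)^i(k-1)^i+\frac{\ell(\ell-1)^{t-1}(k-1)^{t-1}}{c}$$ vertices of valency $k$. That is, $b(k,\ell,\theta)$ is at most this quantity.
   Context: A $(k,\ell)$-semiregular bipartite graph is a bipartite graph with parts $B,C$ where every vertex of $B$ has valency $k$ and every vertex of $C$ has valency $\ell$; $b(k,\ell,\theta)$ denotes the maximum number of vertices of valency $k$ in a $(k,\ell)$-semiregular bipartite graph with second largest adjacency eigenvalue at most $\theta$. For an integer $m\ge4$ and real $c$, $B(k,\ell,m,c)$ is the $m\times m$ tridiagonal matrix with zero main diagonal, subdiagonal entries $(B_{2,1},B_{3,2},\dots,B_{m,m-1})=(1,\dots,1,c,e)$ where $e=k$ if $m$ is odd and $e=\ell$ if $m$ is even, and superdiagonal entries chosen so that the $i$-th row sum is $k$ for $i$ odd and $\ell$ for $i$ even. Thus its rows are $(0,k)$, then $(1,0,\ell-1)$, $(1,0,k-1)$, … alternately, then the row $(m-1)$ with entries $c$ (subdiagonal) and $s-c$ (superdiagonal) where $s$ is that row's prescribed sum, and the last row with single subdiagonal entry $e$. *)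

(* Defs.v *)
From mathcomp Require Import all_boot all_order all_algebra reals polyrcf.

Set Implicit Arguments.
Unset Strict Implicit.
Unset Printing Implicit Defensive.

Import Order.TTheory GRing.Theory Num.Theory.
Local Open Scope ring_scope.

(* The real eigenvalues of M, repeated according to their multiplicity as roots
   of the characteristic polynomial, in nonincreasing order ([rootsR] lists the
   distinct real roots in increasing order). *)
Definition eigenvalues (R : realType) (n : nat) (M : 'M[R]_n) : seq R :=
  rev (flatten
    [seq nseq (mup x (char_poly M)) x | x <- rootsR (char_poly M)]).

(* The default value 0 is only reached when M has fewer than two real
   eigenvalues; for adjacency matrices this means at most one vertex. *)
Definition second_eigenvalue (R : realType) (n : nat) (M : 'M[R]_n) : R :=
  (eigenvalues M)`_1.

Definition adjacency_mx (R : realType) (V : finType) (e : rel V)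
    : 'M[R]_#|V| :=
  \matrix_(i, j) (e (enum_val i) (enum_val j))%:R.

(* The relation e is the edge set of a simple graph on V.  The parts are data:
   when k = l the valency alone does not tell B from C. *)
Record semiregular_bipartite (V : finType) (e : rel V) (B C : {set V})
    (k l : nat) : Prop := SemiregularBipartite {
  adj_sym : symmetric e;
  adj_irr : irreflexive e;
  parts_cover : B :|: C = [set: V];
  parts_disjoint : [disjoint B & C];
  adj_bipartite : forall x y, e x y -> (x \in B) = (y \in C);
  valency_B : forall x, x \in B -> #|[set y | e x y]| = k;
  valency_C : forall x, x \in C -> #|[set y | e x y]| = l
}.

(* Matrix indices start at 0, so the rows with odd 1-based number, those whose
   sum is k, are the rows of even index. *)
Section SemiregularMatrix.
Variables (R : realType) (k l m : nat) (c : R).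

Definition Brow_sum (i : nat) : R := if odd i then l%:R else k%:R.

(* The entry (i, i.-1), for 0 < i. *)
Definition Bsub (i : nat) : R :=
  if i == m.-1 then (if odd m then k%:R else l%:R)
  else if i == m.-2 then c
  else 1.

(* The entry (i, i.+1). *)
Definition Bsuper (i : nat) : R :=
  if i == 0%N then Brow_sum i else Brow_sum i - Bsub i.

Definition Bmx : 'M[R]_m :=
  \matrix_(i, j)
    (if i == j.+1 :> nat then Bsub i
     else if j == i.+1 :> nat then Bsuper i
     else 0).

End SemiregularMatrix.

(* Main.v *)
(* Linear programming with nonbacktracking walks.  Put a = k + l - 2 and
   p = (k-1)(l-1), so that kl = a + p + 1, and let Q_i be the polynomials such
   that H_i = A Q_i(A^2) counts the nonbacktracking walks of length 2i+1 of the
   graph.  They satisfy a three-term recurrence with Q_i(kl) = p^i, and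
   S_n = Q_0 + ... + Q_n satisfies the same recurrence.  The characteristic
   polynomial of B(k,l,2t+1,c) is a multiple of X (X^2 - kl) Psi(X^2), where
   Psi = Q_{t-1} + c S_{t-2} has all its roots below kl; hence its second
   eigenvalue is at most sqrt y (read as 0 for y < 0), y being the largest root
   of Psi.  With q = Psi / (X - y), the test function f = X Psi q is nonpositive
   on {0} and on [0, y], so the trace of f(A^2) is at most 2 f(kl).  On the
   other hand q is a nonnegative combination of the S_j, so this trace is
   bounded below by traces of the H_i^2, and tr H_i^2 is at least the sum of the
   entries of H_i because these are natural numbers.  This gives
   2 c k |B| q(kl) <= 2 kl Psi(kl) q(kl), i.e. |B| <= l Psi(kl) / c. *)
Require Import Defs.
From mathcomp Require Import all_boot all_order all_algebra reals polyrcf.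
From mathcomp Require Import complex ring lra zify.

Set Implicit Arguments.
Unset Strict Implicit.
Unset Printing Implicit Defensive.

Import Order.TTheory GRing.Theory Num.Theory.
Local Open Scope ring_scope.

(** * Polynomials with a three-term recurrence *)

Lemma pair_ind (P : nat -> Prop) :
  P 0 -> P 1 -> (forall n, P n -> P n.+1 -> P n.+2) -> forall n, P n.
Proof.
move=> P0 P1 PS n; suff: P n /\ P n.+1 by case.
by elim: n => // n [Pn PSn]; split=> //; apply: PS.
Qed.

Section JacobiPolynomials.
Variables (R : comNzRingType) (a p : R).
Implicit Types (b c x y : R) (n : nat).

(* In the notation of the header, Q is the case b = a + 1, S the case b = a and
   Psi the case b = a + 1 - c. *)
Fixpoint jacobi b n : {poly R} :=
  if n is n'.+1 then
    if n' is n''.+1 then ('X - a%:P) * jacobi b n' - p%:P * jacobi b n''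
    else 'X - b%:P
  else 1.
#[global] Arguments jacobi b n : simpl never.

Lemma jacobi0 b : jacobi b 0 = 1. Proof. by []. Qed.

Lemma jacobi1 b : jacobi b 1 = 'X - b%:P. Proof. by []. Qed.

Lemma jacobiSS b n :
  jacobi b n.+2 = ('X - a%:P) * jacobi b n.+1 - p%:P * jacobi b n.
Proof. by []. Qed.

Lemma horner_jacobiSS b n x :
  (jacobi b n.+2).[x] = (x - a) * (jacobi b n.+1).[x] - p * (jacobi b n).[x].
Proof. by rewrite jacobiSS !hornerE. Qed.

Lemma jacobi_monic_size b n :
  jacobi b n \is monic /\ size (jacobi b n) = n.+1.
Proof.
elim/pair_ind: n => [||n [m0 s0] [m1 s1]].
- by rewrite jacobi0 monic1 size_poly1.
- by rewrite jacobi1 monicXsubC size_XsubC.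
have s2 : size (('X - a%:P) * jacobi b n.+1) = n.+3.
  by rewrite size_Mmonic ?size_XsubC ?s1 ?monic_neq0 // monicXsubC.
have lt : (size (- (p%:P * jacobi b n)) < size (('X - a%:P) * jacobi b n.+1)%R)%N.
  rewrite s2 size_polyN (leq_ltn_trans (size_polyMleq _ _)) // s0.
  by rewrite addnS /= -(add3n n) ltn_add2r ltnS (leq_trans (size_polyC_leq1 p)).
rewrite jacobiSS size_polyDl // s2; split=> //.
by rewrite monicE lead_coefDl // -monicE monicMl ?monicXsubC.
Qed.

(** The parameter [b] enters only at degree one, so the difference of the two families solves the
    recurrence from initial values [0] and [c]: it is [c] times the family for [a], shifted by
    one. *)
Lemma jacobiB b c n :
  jacobi (b - c) n.+1 = jacobi b n.+1 + c%:P * jacobi a n.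
Proof.
elim/pair_ind: n => [||n IH0 IH1].
- by rewrite !jacobi1 jacobi0 polyCB; ring.
- by rewrite !jacobiSS !jacobi1 !jacobi0 polyCB; ring.
by rewrite (jacobiSS (b - c)) IH0 IH1 !jacobiSS; ring.
Qed.

Lemma sum_jacobi n : \sum_(i < n.+1) jacobi (a + 1) i = jacobi a n.
Proof.
elim: n => [|n IH]; first by rewrite big_ord1 !jacobi0.
rewrite big_ord_recr /= IH.
by have := jacobiB a (-1) n; rewrite opprK => ->; rewrite polyCN; ring.
Qed.

(** A Christoffel-Darboux type identity. At a root [y] of [Psi] it expands [Psi / (X - y)] in the
    [S_i], with values of lower members of the [Psi] family at [y] as coefficients. *)
Lemma jacobi_divided_difference b n x y :
  (jacobi b n.+1).[x] - (jacobi b n.+1).[y] =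
  (x - y) * \sum_(i < n.+1) (jacobi b (n - i)).[y] * (jacobi a i).[x].
Proof.
elim/pair_ind: n => [||n IH0 IH1].
- by rewrite big_ord1 subnn !jacobi1 !jacobi0 !hornerE /=; ring.
- rewrite !big_ord_recr big_ord0 /= subnn subn0 !jacobiSS !jacobi1 !jacobi0 !hornerE /=; ring.
(* The last two terms are split off because the recurrence in [b] does not reach degrees 1 and 0. *)
have E m : \sum_(i < m.+3) (jacobi b (m.+2 - i)).[y] * (jacobi a i).[x] =
   (jacobi a m.+2).[x] + (y - b) * (jacobi a m.+1).[x] +
   \sum_(i < m.+1) (jacobi b (m.+2 - i)).[y] * (jacobi a i).[x].
  rewrite !big_ord_recr /= subnn.
  by rewrite (_ : m.+2 - m.+1 = 1)%N; [rewrite !jacobi1 jacobi0 !hornerE /=; ring | lia].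
rewrite E.
have E2 : \sum_(i < n.+1) (jacobi b (n.+2 - i)).[y] * (jacobi a i).[x] =
  (y - a) * (\sum_(i < n.+2) (jacobi b (n.+1 - i)).[y] * (jacobi a i).[x]
     - (jacobi a n.+1).[x])
  - p * \sum_(i < n.+1) (jacobi b (n - i)).[y] * (jacobi a i).[x].
  rewrite [X in _ * (X - _)]big_ord_recr /= subnn jacobi0 hornerC mul1r addrK.
  rewrite !mulr_sumr -sumrB; apply: eq_bigr => i _.
  have [e1 e2] : (n.+2 - i = (n - i).+2 /\ n.+1 - i = (n - i).+1)%N.
    by have := ltn_ord i; lia.
  by rewrite e1 e2 horner_jacobiSS; ring.
rewrite E2 (horner_jacobiSS b n.+1 x) (horner_jacobiSS b n.+1 y).
have -> : forall s1 s0 : R,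
    (x - y) * ((jacobi a n.+2).[x] + (y - b) * (jacobi a n.+1).[x] +
      ((y - a) * (s1 - (jacobi a n.+1).[x]) - p * s0)) =
    (x - y) * ((jacobi a n.+2).[x] + (a - b) * (jacobi a n.+1).[x]) +
      (y - a) * ((x - y) * s1) - p * ((x - y) * s0).
  by move=> s1 s0; ring.
rewrite -IH0 -IH1.
have := jacobiB a (a - b) n.+1; rewrite subKr => /(congr1 (horner^~ x)).
by rewrite !hornerE => <-; ring.
Qed.


(** Both sides obey the same recurrence. At [X = a + p + 1], which is [kl] for the graph, the right
    side vanishes and each [Q_n] becomes [p] times its predecessor. *)
Lemma jacobi_top n :
  jacobi (a + 1) n.+1 - p%:P * jacobi (a + 1) n =
  ('X - (a + p + 1)%:P) * jacobi a n.
Proof.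
elim/pair_ind: n => [||n IH0 IH1].
- by rewrite jacobi1 !jacobi0 !(polyCD, polyC1); ring.
- by rewrite jacobiSS !jacobi1 !jacobi0 !(polyCD, polyC1); ring.
have -> : ('X - (a + p + 1)%:P) * jacobi a n.+2 =
  ('X - a%:P) * (('X - (a + p + 1)%:P) * jacobi a n.+1) 
  - p%:P * (('X - (a + p + 1)%:P) * jacobi a n) by rewrite jacobiSS; ring.
by rewrite -IH0 -IH1 !jacobiSS; ring.
Qed.

Lemma horner_jacobi_top n : (jacobi (a + 1) n).[a + p + 1] = p ^+ n.
Proof.
elim: n => [|n IH]; first by rewrite jacobi0 hornerC.
have /(congr1 (horner^~ (a + p + 1))) := jacobi_top n.
by rewrite !hornerE subrr mul0r IH -exprS => /eqP; rewrite subr_eq0 => /eqP.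
Qed.

End JacobiPolynomials.

(** * Positivity and the largest root of [Psi] *)

Section LargestRoot.
Variables (R : rcfType) (a p c : R).
Hypotheses (p_ge0 : 0 <= p) (c_gt0 : 0 < c).
Local Notation Psi := (jacobi a p (a + 1 - c)).

(** The induction carries [p Psi_n < Psi_{n+1}]: since [x - a >= p + 1], the recurrence gives
    [Psi_{n+2} - p Psi_{n+1} >= Psi_{n+1} - p Psi_n]. *)
Lemma jacobi_gt0 n (x : R) : a + p + 1 <= x -> 0 < (Psi n).[x].
Proof.
move: c_gt0 => c0 hx.
suff: 0 < (Psi n).[x] /\ p * (Psi n).[x] < (Psi n.+1).[x] by case.
elim: n => [|n [Pn Pn1]].
  by rewrite jacobi0 jacobi1 !hornerE ltr01; split=> //=; lra.
have P1 : 0 < (Psi n.+1).[x] by apply: le_lt_trans Pn1; rewrite mulr_ge0 // ltW.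
split=> //; rewrite horner_jacobiSS.
have : 0 <= (x - (a + p + 1)) * (Psi n.+1).[x] by apply: mulr_ge0; [rewrite subr_ge0 | exact: ltW].
lra.
Qed.

(** Largest roots do not decrease with the degree: at the largest root [y] of [Psi_{n+1}],
    [Psi_{n+2}] equals [-p Psi_n(y) <= 0], while it is positive at [a + p + 1]. The clause on all
    lower degrees later makes the coefficients of [q] nonnegative. *)
Lemma jacobi_largest_root n :
  exists y : R, [/\ y < a + p + 1, root (Psi n.+1) y,
    forall i x, (i <= n.+1)%N -> y <= x -> 0 <= (Psi i).[x]
    & forall x, y < x -> 0 < (Psi n.+1).[x]].
Proof.
elim: n => [|n [y [ylt yroot yge ygt]]].
  exists (a + 1 - c); split.
  - by move: p_ge0 c_gt0; lra.
  - by rewrite jacobi1 root_XsubC.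
  - by case=> [|[|]] // x _ hx; rewrite ?jacobi0 ?jacobi1 !hornerE ?subr_ge0.
  - by move=> x hx; rewrite jacobi1 !hornerE subr_gt0.
have y_le0 : (Psi n.+2).[y] <= 0.
  rewrite horner_jacobiSS (rootP yroot) mulr0 sub0r oppr_le0 mulr_ge0 //.
  by rewrite yge.
have top_gt0 := @jacobi_gt0 n.+2 (a + p + 1) (lexx _).
have P0 : Psi n.+2 != 0.
  by apply: contraTneq top_gt0 => ->; rewrite horner0 ltxx.
have [z0 /andP[yz0 _] z0root] :
    exists2 z0, y <= z0 <= a + p + 1 & root (Psi n.+2) z0.
  by apply: poly_ivt; rewrite ?y_le0 ltW.
have rootsE z : (z \in rootsR (Psi n.+2)) = root (Psi n.+2) z.
  by rewrite -roots_on_rootsR //= in_itv.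
pose z := \big[Num.max/z0]_(r <- rootsR (Psi n.+2)) r.
have zroot : root (Psi n.+2) z.
  rewrite /z big_seq; elim/big_ind: _ => //.
  - by move=> u v ur vr; case: (leP u v).
  - by move=> u; rewrite rootsE.
have le_z r : root (Psi n.+2) r -> r <= z.
  by rewrite -rootsE => rin; apply: le_bigmax_seq.
have zpos x : z < x -> 0 < (Psi n.+2).[x].
  move=> zx; case: (ltP x (a + p + 1)) => hx; last exact: jacobi_gt0.
  rewrite ltNge; apply/negP => x_le0.
  have [|r /andP[xr _] /le_z rz] := @poly_ivt _ (Psi n.+2) x (a + p + 1) (ltW hx).
    by rewrite x_le0 ltW.
  by move: (lt_le_trans zx xr); rewrite ltNge rz.
have yz : y <= z by apply: le_trans (le_z _ z0root).
exists z; split=> //.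
- rewrite ltNge; apply/negP => /(@jacobi_gt0 n.+2).
  by rewrite (rootP zroot) ltxx.
- move=> i x; rewrite leq_eqVlt => /orP[/eqP->|ilt] zx.
    by move: zx; rewrite le_eqVlt => /orP[/eqP<-|/zpos/ltW //]; rewrite (rootP zroot).
  by apply: yge => //; apply: le_trans zx.
Qed.

End LargestRoot.

(** * The spectrum of B(k,l,m,c) *)

Section Eigenvalues.
Variables (R : realType) (n : nat) (M : 'M[R]_n).

Lemma count_eigenvalues x : count_mem x (eigenvalues M) = mup x (char_poly M).
Proof.
rewrite /eigenvalues count_rev count_flatten sumnE !big_map.
set p := char_poly M.
have p0 : p != 0 by rewrite monic_neq0 ?char_poly_monic.
have rootsE : (x \in rootsR p) = root p x by rewrite -roots_on_rootsR.
under eq_bigr do rewrite count_nseq.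
have [xr|xNr] := boolP (x \in rootsR p).
  rewrite (bigD1_seq x) ?uniq_roots //= eqxx mul1n big1 ?addn0 // => z zx.
  by rewrite (negPf zx).
rewrite big_seq big1 => [|z zr]; first by rewrite mupNroot // -rootsE.
by rewrite /= (negPf (memPn xNr z zr)).
Qed.

Lemma eigenvalues_sorted : sorted >=%R (eigenvalues M).
Proof.
rewrite /eigenvalues rev_sorted; set p := char_poly M.
have := sorted_roots (- cauchy_bound p) (cauchy_bound p) p.
rewrite -/(rootsR p) (sorted_pairwise lt_trans).
rewrite (sorted_pairwise le_trans).
elim: (rootsR p) => //= x s IH /andP[xs /IH{}IH].
rewrite pairwise_cat IH andbT; apply/andP; split.
  apply/allrelP => u v /nseqP[-> _] /flattenP[w /mapP[z zs ->] /nseqP[-> _]].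
  exact: ltW (allP xs _ zs).
by elim: (mup x p) => //= m ->; rewrite andbT; apply/allP => y /nseqP[-> _].
Qed.

(** Nonnegativity of [theta] accounts for the default value 0 when there are fewer than two
    eigenvalues. *)
Lemma second_eigenvalue_le (theta : R) : 0 <= theta ->
  (second_eigenvalue M <= theta) =
  (count (fun x => (theta < x)%R) (eigenvalues M) <= 1)%N.
Proof.
rewrite /second_eigenvalue => th0; have := eigenvalues_sorted.
case: (eigenvalues M) => [|x [|y s]] /=; rewrite ?th0 ?addn0 ?leq_b1 //.
case/andP=> yx; rewrite (path_sortedE (fun _ _ _ h1 h2 => le_trans h2 h1)).
case/andP=> ys _; case: (leP y theta) => [yth|thy]; last first.
  by rewrite (lt_le_trans thy yx).
rewrite add0n (_ : count _ s = 0%N) ?addn0 ?leq_b1 //.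
rewrite -size_filter (_ : filter _ s = [::]) //; apply/eqP.
rewrite -[_ == _]negbK -has_filter; apply/hasPn => z /(allP ys) zy.
by rewrite -leNgt (le_trans zy).
Qed.

Lemma perm_eigenvalues (s : seq R) :
  char_poly M = \prod_(x <- s) ('X - x%:P) -> perm_eq (eigenvalues M) s.
Proof.
by move=> ps; apply/allP => x _ /=; apply/eqP; rewrite count_eigenvalues ps mu_prod_XsubC.
Qed.

End Eigenvalues.

(** * The characteristic polynomial of B(k,l,2t+1,c) *)

Section SemiregularCharPoly.
Variables (R : realType) (k l : nat) (c : R).
Hypotheses (k_gt0 : (0 < k)%N) (c_gt0 : 0 < c).

Local Notation a := (k%:R + l%:R - 2 : R).
Local Notation p := ((k%:R - 1) * (l%:R - 1) : R).
Local Notation Psi := (jacobi a p (a + 1 - c)).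
Local Notation Q := (jacobi a p (a + 1)).

(* The left eigenvector equation v B = x v, solved from v_0 = 1, gives v_i =
   tree_poly i up to the last two coordinates. *)
Fixpoint tree_poly (i : nat) : {poly R} :=
  match i with
  | 0 => 1
  | 1 => 'X
  | (i'.+1 as i1).+1 =>
    'X * tree_poly i1 - (Brow_sum R k l i' - (0 < i')%N%:R)%:P * tree_poly i'
  end.
#[global] Arguments tree_poly i : simpl never.

Lemma tree_polySS i : tree_poly i.+2 =
  'X * tree_poly i.+1 - (Brow_sum R k l i - (0 < i)%N%:R)%:P * tree_poly i.
Proof. by []. Qed.

(** Eliminating the even-indexed polynomials leaves a three-term recurrence in [X^2]. The
    exceptional first step, with [k] in place of [k - 1], produces the initial parameter [a + 1]. *)
Lemma tree_poly_odd i : tree_poly i.*2.+1 = 'X * (Q i \Po 'X^2).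
Proof.
elim/pair_ind: i => [||i IH0 IH1].
- by rewrite jacobi0 comp_polyC mulr1.
- rewrite jacobi1 comp_polyB comp_polyX comp_polyC !tree_polySS.
  by rewrite /Brow_sum /= /tree_poly !(polyCB, polyCD, polyC1); ring.
rewrite jacobiSS comp_polyB !comp_polyM comp_polyB comp_polyX !comp_polyC.
have -> : 'X * (('X^2 - a%:P) * (Q i.+1 \Po 'X^2) - p%:P * (Q i \Po 'X^2)) =
  ('X^2 - a%:P) * tree_poly i.*2.+3 - p%:P * tree_poly i.*2.+1.
  by rewrite IH0 IH1; ring.
have e4 := tree_polySS i.*2.+2; have e3 := tree_polySS i.*2.+1.
have e5 := tree_polySS i.*2.+3; rewrite /Brow_sum /= odd_double /= in e3 e4 e5.
rewrite !doubleS e5.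
have -> : 'X * tree_poly i.*2.+4 = 'X^2 * tree_poly i.*2.+3
    - (k%:R - 1)%:P * (tree_poly i.*2.+3 + (l%:R - 1)%:P * tree_poly i.*2.+1).
  by rewrite e4 e3; ring.
by rewrite !(polyCB, polyCD, polyCM, polyC1); ring.
Qed.

Section LeftVector.
Variable n : nat.
Local Notation m := (n.*2.+3.+2).
Local Notation B := (Bmx k l m c).

(* The constants undo the subdiagonal entries c and k of the last two rows. *)
Definition tree_row (j : nat) : {poly R} :=
  if j == n.*2.+4 then
    (c * k%:R)^-1%:P *
    ('X * tree_poly n.*2.+3 - (c * (k%:R - 1))%:P * tree_poly n.*2.+2)
  else if j == n.*2.+3 then c^-1%:P * tree_poly n.*2.+3
  else tree_poly j.

Lemma row_mul_charmx (v : nat -> {poly R}) (j : 'I_m) :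
  ((\row_(i < m) v i) *m char_poly_mx B) 0 j = 'X * v j
    - ((if (j.+1 < m)%N then v j.+1 * (Bsub k l m c j.+1)%:P else 0) +
       (if (0 < j)%N then v j.-1 * (Bsuper k l m c j.-1)%:P else 0)).
Proof.
rewrite !mxE /char_poly_mx.
pose f i := v i * (Bsub k l m c i)%:P.
pose g i := v i * (Bsuper k l m c i)%:P.
have E (i : 'I_m) : (\row_(i < m) v i) 0 i * ('X%:M - map_mx polyC B) i j =
  (if i == j then 'X * v j else 0)
  - ((if i == j.+1 :> nat then f i else 0) +
  (if j == i.+1 :> nat then g i else 0)).
  rewrite !mxE mulrBr; congr (_ - _).
    case: eqVneq => [->|]; first by rewrite mulr1n mulrC.
    by rewrite mulr0n mulr0.
  case: eqP => [ij|_].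
    by rewrite ltn_eqF ?addr0 // ij.
  by rewrite add0r; case: eqP; rewrite // polyC0 mulr0.
rewrite (eq_bigr _ (fun i _ => E i)) sumrB -big_mkcond big_pred1_eq.
congr (_ - _); rewrite big_split /=; congr (_ + _).
  by rewrite -big_mkcond (big_ord1_eq _ f).
case: j {E} => [[|j] jm] /=; first by rewrite big1.
rewrite (eq_bigr (fun i : 'I_m => if i == j :> nat then g i else 0)) => [|i _].
  by rewrite -big_mkcond (big_ord1_eq _ g) ltnW.
by rewrite eqSS eq_sym.
Qed.

(** Each column equation determines the next entry of [tree_row]; the last column has no further
    entry to absorb its residue, which is the right-hand side. *)
Lemma tree_row_charmx :
  (\row_(j < m) tree_row j) *m char_poly_mx B =
  \row_(j < m) (if j == n.*2.+4 :> nat then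
     (c * k%:R)^-1%:P * ('X * (('X - (k * l)%:R%:P) * Psi n.+1 \Po 'X^2))
     else 0).
Proof.
have c0 : c != 0 by rewrite gt_eqF.
have k0 : k%:R != 0 :> R by rewrite pnatr_eq0 -lt0n.
have ck0 : c * k%:R != 0 by rewrite mulf_neq0.
apply/rowP => j; rewrite row_mul_charmx mxE.
have : (j < m)%N by []; move: (val j) => {}j jm.
have kc_inv : c^-1 = (c * k%:R)^-1 * k%:R by rewrite invfM mulfVK.
have [->|[->|jn]] : j = n.*2.+4 \/ j = n.*2.+3 \/ (j <= n.*2.+2)%N by lia.
- rewrite ltnn eqxx add0r /= /tree_row eqxx (ltn_eqF (ltnSn _)) eqxx.
  rewrite (_ : Bsuper k l m c n.*2.+3 = l%:R - c); last first.
    by rewrite /Bsuper /Bsub /Brow_sum /= (ltn_eqF (ltnSn _)) eqxx odd_double.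
  rewrite kc_inv [(_ * k%:R)%:P]polyCM; move: ((c * k%:R)^-1)%:P => u.
  have e1 := tree_poly_odd n; have e3 := tree_poly_odd n.+1.
  have e2 : 'X * tree_poly n.*2.+2 = tree_poly n.*2.+3 + (l%:R - 1)%:P * tree_poly n.*2.+1.
    by rewrite (tree_polySS n.*2.+1) /Brow_sum /= odd_double; ring.
  have -> : 'X * (u * ('X * tree_poly n.*2.+3
       - (c * (k%:R - 1))%:P * tree_poly n.*2.+2))
     - u * k%:R%:P * tree_poly n.*2.+3 * (l%:R - c)%:P
   = u * ('X^2 * tree_poly n.*2.+3
       - (c * (k%:R - 1))%:P * ('X * tree_poly n.*2.+2) - k%:R%:P * (l%:R - c)%:P * tree_poly n.*2.+3) by ring.
  rewrite e2 e1 e3; congr (_ * _).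
  have <- : a + p + 1 = (k * l)%:R by rewrite natrM; ring.
  (* [jacobi_top] turns [(X - kl) S_n] into [Q_{n+1} - p Q_n], the form in which the last column
     presents it. *)
  have -> : ('X - (a + p + 1)%:P) * Psi n.+1 = ('X - (a + p + 1)%:P) * Q n.+1
      + c%:P * (Q n.+1 - p%:P * Q n) by rewrite jacobiB jacobi_top; ring.
  rewrite !(comp_polyD, comp_polyB, comp_polyM, comp_polyX, comp_polyC).
  by rewrite !(polyCB, polyCD, polyCM, polyC1); ring.
- rewrite (ltn_eqF (ltnSn _)) ltnSn /= /tree_row eqxx (ltn_eqF (ltnSn _)) !eqxx.
  rewrite !ltn_eqF //.
  rewrite (_ : Bsuper k l m c n.*2.+2 = k%:R - 1); last first.
    by rewrite /Bsuper /Bsub /Brow_sum /= !ltn_eqF // odd_double.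
  rewrite (_ : Bsub k l m c n.*2.+4 = k%:R); last first.
    by rewrite /Bsub /= eqxx odd_double.
  rewrite kc_inv [(_ * k%:R)%:P]polyCM.
  have : ((c * k%:R)^-1)%:P * (c * k%:R)%:P = 1 :> {poly R} by rewrite -polyCM mulVf.
  move: ((c * k%:R)^-1)%:P => u.
  rewrite !(polyCB, polyCD, polyCM, polyC1) => E.
  have -> : forall f g : {poly R}, 'X * (u * k%:R%:P * f) -
    (u * ('X * f - c%:P * (k%:R%:P - 1) * g) * k%:R%:P + g * (k%:R%:P - 1)) =
     (u * (c%:P * k%:R%:P) - 1) * (k%:R%:P - 1) * g by move=> f g; ring.
  by rewrite E subrr !mul0r.
rewrite ltnS (leq_ltn_trans jn) // (@ltn_eqF j n.*2.+4); last by lia.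
rewrite {1}/tree_row (@ltn_eqF j n.*2.+4) ?(@ltn_eqF j n.*2.+3) ?ltnS //; last by lia.
have low i : (i <= n.*2.+1)%N -> tree_row i = tree_poly i /\
   Bsuper k l m c i = Brow_sum R k l i - (0 < i)%N%:R.
  move=> le_i; rewrite /tree_row /Bsuper /Bsub /=.
  rewrite (@ltn_eqF i n.*2.+4) ?(@ltn_eqF i n.*2.+3); try lia.
  by split=> //; case: i {le_i} => //=; rewrite subr0.
have -> : (if (0 < j)%N then tree_row j.-1 * (Bsuper k l m c j.-1)%:P else 0) =
  'X * tree_poly j - tree_poly j.+1.
  case: j jn {jm} => [|j] jn /=; first by rewrite /tree_poly mulr1 subrr.
  by have [-> ->] := low j jn; rewrite tree_polySS; ring.
have -> : tree_row j.+1 * (Bsub k l m c j.+1)%:P = tree_poly j.+1; last by ring.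
move: jn; rewrite leq_eqVlt => /orP[/eqP->|jn].
  rewrite /tree_row /Bsub /= !eqxx !(ltn_eqF (ltnSn _)).
  by rewrite mulrAC -polyCM mulVf // mul1r.
rewrite /tree_row /Bsub /= (@ltn_eqF j.+1 n.*2.+4) ?(@ltn_eqF j.+1 n.*2.+3) ?ltnS //; last by lia.
by rewrite mulr1.
Qed.

(* Multiplying tree_row_charmx by the adjugate exhibits the right-hand side as a
   divisor of char_poly B, of the same degree. *)
Lemma char_poly_Bmx : exists2 h : R, h != 0 &
  char_poly B = h%:P * ('X * (('X - (k * l)%:R%:P) * Psi n.+1 \Po 'X^2)).
Proof.
set P := 'X * _.
have c0 : c != 0 by rewrite gt_eqF.
have k0 : k%:R != 0 :> R by rewrite pnatr_eq0 -lt0n.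
have ck0 : (c * k%:R)^-1 != 0 by rewrite invr_eq0 mulf_neq0.
have lt_last : (n.*2.+4 < m)%N by [].
pose last := Ordinal lt_last.
have /(congr1 (mulmxr (\adj (char_poly_mx B)))) /= := tree_row_charmx.
(* Coordinate 0 is read off because [tree_row 0] is 1, which leaves the bare characteristic
   polynomial. *)
rewrite -mulmxA mul_mx_adj mul_mx_scalar; move: (\adj _) => A /rowP/(_ 0).
rewrite !mxE (bigD1 last) //= big1 ?addr0 => [|i]; last first.
  by rewrite -val_eqE !mxE => /negPf /= ->; rewrite mul0r.
rewrite !mxE eqxx -/P -/(char_poly B) [tree_row _]/(tree_poly 0) mulr1.
rewrite -mulrA; set q := A _ _ => Bq.
have [Pm Ps] : P != 0 /\ size P = m.+1.
  have [m1 s1] := jacobi_monic_size a p (a + 1 - c) n.+1.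
  have Qs : size (('X - (k * l)%:R%:P) * Psi n.+1) = n.+3.
    by rewrite size_Mmonic ?polyXsubC_eq0 // size_XsubC s1.
  have Cs : size (('X - (k * l)%:R%:P) * Psi n.+1 \Po 'X^2) = m.
    have := size_comp_poly (('X - (k * l)%:R%:P) * Psi n.+1) 'X^2.
    rewrite Qs size_polyXn.
    by case: (size (_ \Po _)) => //= s ->; rewrite muln2 doubleS.
  have C0 : ('X - (k * l)%:R%:P) * Psi n.+1 \Po 'X^2 != 0.
    by rewrite -size_poly_gt0 Cs.
  by rewrite /P mulf_neq0 ?polyX_eq0 // mulrC size_mulX ?Cs.
have q0 : q != 0.
  apply: contra_eq_neq Bq => ->.
  by rewrite !mulr0 monic_neq0 // char_poly_monic.
have /eqP : size (char_poly B) = m.+1 by exact: size_char_poly.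
rewrite Bq size_Cmul // size_mul // Ps addSn /= -[X in _ == X]addn1 eqn_add2l.
case/size_poly1P => h h0 qh; exists ((c * k%:R)^-1 * h).
  by rewrite mulf_neq0.
by rewrite qh polyCM; ring.
Qed.

(* For y < 0 the bound reads 0, as Num.sqrt y = 0. *)
Lemma second_eigenvalue_Bmx_le (y : R) : (0 < l)%N -> y < (k * l)%:R ->
  (forall x, y < x -> 0 < (Psi n.+1).[x]) ->
  second_eigenvalue B <= Num.sqrt y.
Proof.
move=> l0 ykl Psi_gt0; have [h h0 Bh] := char_poly_Bmx.
have kl0 : 0 < (k * l)%:R :> R by rewrite ltr0n muln_gt0 k_gt0.
pose r := Num.sqrt (k * l)%:R : R.
have r0 : 0 < r by rewrite sqrtr_gt0.
have r2 : r ^+ 2 = (k * l)%:R by rewrite sqr_sqrtr // ltW.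
rewrite second_eigenvalue_le ?sqrtr_ge0 //.
(* Beyond [sqrt y] the factors [X] and [Psi(X^2)] are positive, so only [X^2 - kl] can vanish;
   afterwards [r] has to be shown a simple root. *)
have big_root x : x \in eigenvalues B -> Num.sqrt y < x -> x = r.
  rewrite -has_pred1 has_count count_eigenvalues.
  rewrite -XsubC_dvd ?monic_neq0 ?char_poly_monic // dvdp_XsubCl Bh => xr yx.
  have x0 : 0 < x by apply: le_lt_trans yx; rewrite sqrtr_ge0.
  have yx2 : y < x ^+ 2.
    have [y0|y0] := leP 0 y; last by rewrite (lt_trans y0) // exprn_gt0.
    by rewrite -(sqr_sqrtr y0) ltr_pXn2r // ?nnegrE ?sqrtr_ge0 // ltW.
  move: xr; rewrite /root !(hornerM, hornerC, hornerX, horner_comp, hornerXsubC, hornerXn).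
  rewrite !mulf_eq0 (negPf h0) (gt_eqF x0) (gt_eqF (Psi_gt0 _ yx2)) /= orbF.
  rewrite subr_eq0 => /eqP x2.
  by rewrite /r -x2 sqrtr_sqr gtr0_norm.
apply: (@leq_trans (count_mem r (eigenvalues B))).
  rewrite [leqLHS](eq_in_count (a2 := predI (pred1 r) (fun x => Num.sqrt y < x))).
    by apply: sub_count => x /= /andP[].
  move=> x /big_root xr /=; case: (boolP (_ < x)) => [/xr ->|_].
    by rewrite eqxx.
  by rewrite andbF.
rewrite count_eigenvalues Bh.
rewrite (_ : _ * _ = ('X - r%:P) ^+ 1 *
  (h%:P * 'X * ('X + r%:P) * (Psi n.+1 \Po 'X^2))).
  rewrite mupMl ?mup_XsubCX ?eqxx // /root.
  rewrite !(horner_comp, hornerXn, hornerM, hornerD, hornerC, hornerX) r2.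
  by rewrite !mulf_neq0 // gt_eqF ?Psi_gt0 ?addr_gt0.
rewrite comp_polyM comp_polyB comp_polyX comp_polyC -r2 polyC_exp; ring.
Qed.

End LeftVector.

End SemiregularCharPoly.

(** * Symmetric matrices *)

Lemma char_poly_similar (F : fieldType) n (P M N : 'M[F]_n) :
  P \in unitmx -> P *m M = N *m P -> char_poly M = char_poly N.
Proof.
move=> Pu PM; have E : map_mx polyC P *m char_poly_mx M = char_poly_mx N *m map_mx polyC P.
  by rewrite mulmxBr mulmxBl -!map_mxM PM mul_mx_scalar mul_scalar_mx.
have /(congr1 determinant) := E; rewrite !det_mulmx mulrC => /mulIf; apply.
by rewrite det_map_mx polyC_eq0 -unitfE -unitmxE.
Qed.

Section SymmetricMatrices.
Variables (R : rcfType) (n : nat).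
Implicit Types (A : 'M[R]_n) (d : 'rV[R]_n).
Local Notation toC := (map_mx (real_complex R)).

Lemma symmetric_real_spectral A : A^T = A ->
  exists (P : 'M[R[i]]_n) d,
    P \in unitmx /\ P *m toC A = diag_mx (toC d) *m P.
Proof.
move=> A_sym; pose AC := toC A.
have AC_herm : AC \is hermsymmx.
  apply: realsym_hermsym.
    apply/is_hermitianmxP; rewrite expr0 scale1r map_mx_id // /AC.
    by rewrite map_trmx A_sym.
  by apply/mxOverP => i j; rewrite mxE; apply/complex_realP; exists (A i j).
have /orthomx_spectralP AE := hermitian_normalmx AC_herm.
have /mxOverP d_real := hermitian_spectral_diag_real AC_herm.
exists (spectralmx AC), (map_mx (@complex.Re R) (spectral_diag AC)).
split; first exact: spectral_unit.
rewrite -map_mx_comp map_mx_id_in => [|i j]; last by rewrite /= RRe_real.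
by rewrite -/AC {2}AE !mulmxA mulmxV ?spectral_unit // mul1mx.
Qed.

Lemma char_poly_spectral A P d : P \in unitmx ->
  P *m toC A = diag_mx (toC d) *m P ->
  char_poly A = \prod_(r < n) ('X - (d 0 r)%:P).
Proof.
move=> Pu /(char_poly_similar Pu); rewrite -map_char_poly => E.
apply: (map_poly_inj (real_complex R)); rewrite E char_poly_trig; last first.
  by apply/is_trig_mxP => i j ij; rewrite mxE -val_eqE (ltn_eqF ij).
rewrite rmorph_prod; apply: eq_bigr => r _.
by rewrite rmorphB /= map_polyX map_polyC /= !mxE eqxx mulr1n.
Qed.

Variables (A : 'M[R]_n) (a p : R) (H : nat -> 'M[R]_n).
Hypotheses (A_sym : A^T = A) (H0 : H 0 = A).
Hypothesis H1 : H 1 = A *m (A *m A) - (a + 1) *: A.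
Hypothesis HSS : forall i,
  H i.+2 = H i.+1 *m (A *m A) - a *: H i.+1 - p *: H i.
Local Notation Q := (jacobi a p (a + 1)).

Lemma recursion_comm i : comm_mx (H i) A.
Proof.
rewrite /comm_mx; elim/pair_ind: i => [||i IH0 IH1]; rewrite ?H0 ?H1 ?HSS //.
  by rewrite !(mulmxBl, mulmxBr) -!scalemxAl -!scalemxAr !mulmxA.
rewrite !(mulmxBl, mulmxBr) -!scalemxAl -!scalemxAr IH0 IH1.
by rewrite [A *m (_ *m _)]mulmxA -IH1 !mulmxA.
Qed.

Lemma recursion_sym i : (H i)^T = H i.
Proof.
elim/pair_ind: i => [||i IH0 IH1]; rewrite ?H0 ?H1 ?HSS //.
  by rewrite !(linearB, linearZ) /= !trmx_mul !A_sym !mulmxA.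
rewrite !(linearB, linearZ) /= !trmx_mul !A_sym IH0 IH1.
have E : H i.+1 *m A = A *m H i.+1 by exact: recursion_comm.
by rewrite -[A *m A *m _]mulmxA -E [A *m (H _ *m A)]mulmxA -E mulmxA.
Qed.

(** The hypothesis concerns [A^2] because the all-ones vector of a biregular graph is an eigenvector
    of [A^2], but in general not of [A]. *)
Lemma recursion_eigenvector (v : 'cV[R]_n) x : A *m (A *m v) = x *: v ->
  forall i, H i *m v = (Q i).[x] *: (A *m v).
Proof.
move=> AAv; have HAA M : M *m (A *m A) *m v = x *: (M *m v).
  by rewrite -!mulmxA AAv -scalemxAr.
elim/pair_ind=> [||i IH0 IH1].
- by rewrite H0 jacobi0 hornerC scale1r.
- by rewrite H1 jacobi1 hornerXsubC mulmxBl HAA -scalemxAl -scalerBl.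
rewrite HSS !mulmxBl HAA -!scalemxAl IH0 IH1 !scalerA -!scalerBl.
by rewrite horner_jacobiSS mulrBl.
Qed.

(** One diagonalisation serves [A], [- A] and all [H i], whose eigenvalues are [d Q_i(d^2)]. The
    clause on [- A] lets the symmetry of the spectrum be read on [d] itself. *)
Lemma recursion_spectral : exists d : 'rV[R]_n,
  [/\ char_poly A = \prod_(r < n) ('X - (d 0 r)%:P),
      char_poly (- A) = \prod_(r < n) ('X - (- d 0 r)%:P)
    & forall i j, \tr (H i *m H j) =
        \sum_r d 0 r ^+ 2 * (Q i).[d 0 r ^+ 2] * (Q j).[d 0 r ^+ 2]].
Proof.
have [P [d [Pu PA]]] := symmetric_real_spectral A_sym.
exists d; split; first exact: char_poly_spectral PA.
  rewrite (char_poly_spectral (d := - d) Pu).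
    by apply: eq_bigr => r _; rewrite mxE.
  by rewrite !map_mxN mulmxN PA [diag_mx (- _)]linearN mulNmx.
pose g i : 'rV[R]_n := \row_r (d 0 r * (Q i).[d 0 r ^+ 2]).
have PH i : P *m toC (H i) = diag_mx (toC (g i)) *m P.
  have PAA M e : P *m toC M = diag_mx (toC e) *m P ->
      P *m toC (M *m (A *m A)) = diag_mx (toC (\row_r (e 0 r * d 0 r ^+ 2))) *m P.
    move=> PM; rewrite !map_mxM !mulmxA PM -[_ *m P *m _]mulmxA PA.
    rewrite mulmxA -[_ *m P *m _]mulmxA PA mulmxA !mulmx_diag.
    congr (diag_mx _ *m _); apply/rowP => r; rewrite !mxE.
    by rewrite -!rmorphM expr2 mulrA.
  have gE e : e = g i -> diag_mx (toC e) = diag_mx (toC (g i)) by move->.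
  elim/pair_ind: i {gE} => [||i IH0 IH1].
  - rewrite H0 PA; congr (diag_mx (toC _) *m _); apply/rowP => r.
    by rewrite mxE jacobi0 hornerC mulr1.
  - rewrite H1 map_mxB map_mxZ mulmxBr -scalemxAr (PAA _ _ PA) PA.
    rewrite scalemxAl -mulmxBl -linearZ -raddfB -map_mxZ -map_mxB.
    congr (diag_mx (toC _) *m _); apply/rowP => r.
    by rewrite !mxE jacobi1 hornerXsubC; ring.
  rewrite HSS !map_mxB !map_mxZ !mulmxBr -!scalemxAr (PAA _ _ IH1) IH0 IH1.
  rewrite !scalemxAl -!mulmxBl -!linearZ -!raddfB -!map_mxZ -!map_mxB.
  congr (diag_mx (toC _) *m _); apply/rowP => r.
  by rewrite !mxE horner_jacobiSS; ring.
move=> i j; apply: (@complexI R).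
rewrite -trace_map_mx.
have -> : toC (H i *m H j) = invmx P *m (P *m toC (H i) *m toC (H j)).
  by rewrite map_mxM !mulmxA mulVmx // mul1mx.
rewrite PH -mulmxA PH mulmxA mulmx_diag mxtrace_mulC mulmxK // mxtrace_diag.
rewrite rmorph_sum; apply: eq_bigr => r _.
by rewrite !mxE -rmorphM /=; congr (real_complex R _); ring.
Qed.

End SymmetricMatrices.

(** * Nonbacktracking walks *)

Section NonbacktrackingWalks.
Variables (T : finType) (e : rel T).
Hypothesis e_sym : symmetric e.
Local Open Scope nat_scope.

(* Nonbacktracking walks of length j.+1 from u whose last step is from v to w. *)
Fixpoint nb_walks_by (j : nat) (u v w : T) : nat :=
  if j is j'.+1 then e v w * \sum_(x | x != w) nb_walks_by j' u x v
  else (u == v) && e v w.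

Definition nb_walks j u w := \sum_v nb_walks_by j u v w.

Definition valency v := \sum_w e v w.

(** A walk to [v] extended by the edge to [w] backtracks exactly when it arrived from [w]. *)
Lemma nb_walks_by_split j u v w :
  nb_walks_by j.+1 u v w + e v w * nb_walks_by j u w v = e v w * nb_walks j u v.
Proof. by rewrite /nb_walks [in RHS](bigD1 w) //= mulnDr addnC. Qed.

Lemma nb_walks_by_edge j u v w : e v w * nb_walks_by j u v w = nb_walks_by j u v w.
Proof. by case: j => [|j] /=; case: (e v w); rewrite ?andbF ?mul1n ?mul0n. Qed.

Lemma nb_walks_split j u w :
  nb_walks j.+1 u w + \sum_v e v w * nb_walks_by j u w v =
  \sum_v nb_walks j u v * e v w.
Proof.
rewrite /nb_walks -big_split; apply: eq_bigr => v _ /=.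
by rewrite (nb_walks_by_split j u v w) mulnC.
Qed.

Lemma nb_walks0 u w : nb_walks 0 u w = e u w.
Proof.
rewrite /nb_walks (bigD1 u) //= eqxx big1 ?addn0 // => v vu.
by rewrite eq_sym (negPf vu).
Qed.

Lemma nb_walks1 u w :
  nb_walks 1 u w + (u == w) * valency w = \sum_v nb_walks 0 u v * e v w.
Proof.
rewrite -nb_walks_split; congr (_ + _); rewrite /valency big_distrr.
apply: eq_bigr => v _ /=; rewrite (e_sym v w).
by case: (e w v); case: (u == w).
Qed.

(** A walk ending at [w] has [valency w - 1] nonbacktracking extensions, each of which could step
    back to [w]; the [- 1] is moved to the right because the counts are natural numbers. *)
Lemma nb_walksSS j u w :
  nb_walks j.+2 u w + valency w * nb_walks j u w =
  \sum_v nb_walks j.+1 u v * e v w + nb_walks j u w.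
Proof.
rewrite -nb_walks_split -addnA; congr (_ + _).
rewrite /valency big_distrl {2}/nb_walks -big_split.
apply: eq_bigr => v _.
rewrite -[LHS]/(e w v * nb_walks j u w).
rewrite -[RHS]/(e v w * nb_walks_by j.+1 u w v + nb_walks_by j u v w).
rewrite -(nb_walks_by_split j u w v) (e_sym v w) nb_walks_by_edge.
by rewrite (e_sym w v) nb_walks_by_edge.
Qed.

End NonbacktrackingWalks.

(** * Nonbacktracking matrices of a biregular graph *)

Section BiregularMatrices.
Variables (R : realType) (n : nat) (e : rel 'I_n) (B : {set 'I_n}) (k l : nat).
Hypothesis e_sym : symmetric e.
Hypothesis e_bip : forall x y, e x y -> (x \in B) = (y \notin B).
Hypothesis e_val : forall x, valency e x = if x \in B then k else l.

Local Notation a := (k%:R + l%:R - 2 : R).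
Local Notation p := ((k%:R - 1) * (l%:R - 1) : R).
Local Notation Q := (jacobi a p (a + 1)).

Let A : 'M[R]_n := \matrix_(i, j) (e i j)%:R.
Let D : 'M[R]_n := diag_mx (\row_j (valency e j)%:R).
Let E : 'M[R]_n := D - 1%:M.
(* E' swaps the two valencies of E, i.e. belongs to the opposite part. *)
Let E' : 'M[R]_n := (k%:R + l%:R - 1)%:M - D.

Definition nb_mx j : 'M[R]_n := \matrix_(u, w) (nb_walks e j u w)%:R.

Lemma nb_mx0 : nb_mx 0 = A.
Proof. by apply/matrixP => u w; rewrite !mxE nb_walks0. Qed.

Lemma nb_mx_mulE j u w :
  (nb_mx j *m A) u w = (\sum_v nb_walks e j u v * e v w)%:R.
Proof.
by rewrite mxE natr_sum; apply: eq_bigr => v _; rewrite !mxE natrM.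
Qed.

Lemma nb_mx1 : nb_mx 1 = A *m A - D.
Proof.
apply/matrixP => u w; rewrite -{1}nb_mx0 mxE [in RHS]mxE nb_mx_mulE.
rewrite -(nb_walks1 e_sym) natrD !mxE natrM.
by case: eqVneq => [->|]; rewrite ?mul1r ?mul0r ?mulr1n ?mulr0n ?addrK.
Qed.

Lemma nb_mxSS j : nb_mx j.+2 = nb_mx j.+1 *m A - nb_mx j *m E.
Proof.
apply/matrixP => u w; rewrite /E mulmxBr mulmx1 mul_mx_diag.
rewrite [in RHS]mxE nb_mx_mulE !mxE.
have /(congr1 (fun m : nat => m%:R : R)) := nb_walksSS e_sym j u w.
by rewrite !natrD natrM; lra.
Qed.

Lemma adj_mx_sym : A^T = A.
Proof. by apply/matrixP => i j; rewrite !mxE e_sym. Qed.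

Lemma valencyD x y : e x y -> (valency e x)%:R + (valency e y)%:R = k%:R + l%:R :> R.
Proof.
by rewrite !e_val => /e_bip ->; case: (y \in B) => //=; rewrite addrC.
Qed.

(** Every edge joins the two parts, so moving a diagonal matrix of valencies across [A] exchanges
    [k] and [l]. *)
Lemma adj_mx_mul_swap : A *m E' = E *m A.
Proof.
apply/matrixP => i j; rewrite mulmxBr mulmxBl mul_mx_scalar mul1mx mul_mx_diag.
rewrite mul_diag_mx !mxE; case: (boolP (e i j)) => [/valencyD vD|_] /=.
  by move: vD; lra.
by rewrite !(mulr0, mul0r).
Qed.

Lemma mul_swap : E *m E' = p%:M.
Proof.
rewrite /E /E' -[1%:M]diag_const_mx -[(_ + _ - _)%:M]diag_const_mx -!raddfB /=.
rewrite mulmx_diag -diag_const_mx; congr diag_mx; apply/rowP => j.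
by rewrite !mxE e_val; case: ifP => _; ring.
Qed.

Lemma add_swap : E + E' = a%:M.
Proof.
rewrite addrC /E' /E addrA subrK -raddfB /=; congr _%:M; ring.
Qed.

Lemma nb_mx2 : nb_mx 2 = A *m (A *m A) - (a + 1) *: A.
Proof.
have DE : D = E + 1%:M by rewrite subrK.
rewrite nb_mxSS nb_mx1 nb_mx0 mulmxBl {1}DE mulmxDl mul1mx -adj_mx_mul_swap.
rewrite scalerDl scale1r -[a *: A]mul_mx_scalar -add_swap [_ *m (E + E')]mulmxDr -mulmxA.
by rewrite -!addrA -!opprD; congr (_ - _); rewrite [LHS]addrC addrA.
Qed.

(** Applying [nb_mxSS] repeatedly eliminates the matrices of walks of the other parity; the
    corrections combine into [E + E'] and [E E'], the scalars [a] and [p]. *)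
Lemma nb_mx_step j :
  nb_mx j.+4 = nb_mx j.+2 *m (A *m A) - a *: nb_mx j.+2 - p *: nb_mx j.
Proof.
have PA : nb_mx j.+1 *m A = nb_mx j.+2 + nb_mx j *m E by rewrite nb_mxSS subrK.
rewrite (nb_mxSS j.+2) {1}(nb_mxSS j.+1) mulmxBl -[_ *m E *m A]mulmxA -adj_mx_mul_swap.
rewrite [_ *m (A *m E')]mulmxA PA mulmxDl -[_ *m E *m E']mulmxA mul_swap mul_mx_scalar.
rewrite -[a *: _]mul_mx_scalar -add_swap [_ *m (E + E')]mulmxDr -mulmxA.
by rewrite -!addrA -!opprD; congr (_ - _); rewrite [LHS]addrC addrA.
Qed.

Definition odd_nb_mx i := nb_mx i.*2.

Lemma valency_row : A *m const_mx 1 = \col_i (valency e i)%:R.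
Proof.
apply/colP => i; rewrite !mxE natr_sum.
by apply: eq_bigr => j _; rewrite !mxE mulr1.
Qed.

Lemma adj2_ones : A *m (A *m const_mx 1) = (k * l)%:R *: const_mx 1 :> 'cV[R]_n.
Proof.
rewrite valency_row; apply/colP => i; rewrite !mxE mulr1.
transitivity (\sum_j (e i j)%:R * (if i \in B then l%:R else k%:R) : R).
  apply: eq_bigr => j _; rewrite !mxE e_val.
  by case: (boolP (e i j)) => [/e_bip ->|_]; rewrite ?mul0r //; case: (j \in B).
rewrite -mulr_suml -natr_sum -/(valency e i) e_val.
by case: ifP => _; rewrite natrM // mulrC.
Qed.

Lemma sum_valency : (\sum_i valency e i = 2 * (k * #|B|))%N.
Proof.
have inB : (\sum_(i in B) valency e i = k * #|B|)%N.
  rewrite (eq_bigr (fun=> k)) => [|i iB]; last by rewrite e_val iB.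
  by rewrite sum_nat_const mulnC.
rewrite (bigID (mem B)) /= inB mul2n -addnn; congr (_ + _)%N; rewrite -inB.
rewrite /valency [RHS]exchange_big /= big_mkcond; apply: eq_bigr => j _ /=.
case: (boolP (j \in B)) => jB /=.
  rewrite big1 // => i iB; case: (boolP (e i j)) => // /e_bip.
  by rewrite iB jB.
rewrite [in RHS]big_mkcond; apply: eq_bigr => i _; rewrite e_sym.
case: (boolP (e i j)) => [/e_bip ->|_]; first by rewrite jB.
by case: ifP.
Qed.

Lemma odd_nb_mx_trace i j : 0 <= \tr (odd_nb_mx i *m odd_nb_mx j).
Proof.
apply: sumr_ge0 => u _; rewrite mxE; apply: sumr_ge0 => w _.
by rewrite !mxE mulr_ge0 ?ler0n.
Qed.

(* The entries x of the matrix are natural numbers, so x^2 >= x, and the row sums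
   are p^i times the valencies. *)
Lemma odd_nb_mx_trace_diag i :
  2 * (k%:R * #|B|%:R) * p ^+ i <= \tr (odd_nb_mx i *m odd_nb_mx i).
Proof.
have H0 : odd_nb_mx 0 = A by exact: nb_mx0.
have H1 : odd_nb_mx 1 = A *m (A *m A) - (a + 1) *: A by exact: nb_mx2.
have HSS m : odd_nb_mx m.+2 = odd_nb_mx m.+1 *m (A *m A) - a *: odd_nb_mx m.+1
  - p *: odd_nb_mx m by exact: nb_mx_step.
have Hsym := recursion_sym adj_mx_sym H0 H1 HSS i.
have := recursion_eigenvector H0 H1 HSS adj2_ones i.
rewrite (_ : (k * l)%:R = a + p + 1); last by rewrite natrM; ring.
rewrite horner_jacobi_top valency_row => Hrow.
(* By symmetry the trace of the square is the sum of the squared entries. *)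
rewrite -{2}Hsym.
have -> : 2 * (k%:R * #|B|%:R) * p ^+ i = \sum_u \sum_w odd_nb_mx i u w.
  rewrite -!natrM -sum_valency natr_sum mulr_suml; apply: eq_bigr => u _.
  have /colP/(_ u) := Hrow; rewrite !mxE mulrC => <-.
  by apply: eq_bigr => w _; rewrite !mxE mulr1.
apply: ler_sum => u _; rewrite mxE; apply: ler_sum => w _; rewrite !mxE.
by rewrite -natrM ler_nat; case: nb_walks => // m; rewrite leq_pmulr.
Qed.

(** Changing signs on one part conjugates [A] to [- A]. *)
Lemma char_poly_adjN : char_poly (- A) = char_poly A.
Proof.
pose S : 'M[R]_n := diag_mx (\row_i (if i \in B then 1 else -1)).
have S2 : S *m S = 1%:M.
  rewrite mulmx_diag -diag_const_mx; congr diag_mx; apply/rowP => i.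
  by rewrite !mxE; case: ifP => _; rewrite ?mulrNN mulr1.
apply: (@char_poly_similar _ _ S); first by case: (mulmx1_unit S2).
apply/matrixP => i j; rewrite mul_diag_mx mul_mx_diag !mxE.
case: (boolP (e i j)) => [/e_bip ->|_]; last by rewrite mul0r oppr0 mulr0.
by case: (j \in B); rewrite /= ?mul1r ?mulr1 ?mulrNN ?mul1r ?mulrN1.
Qed.

(** An eigenvector takes at each vertex the square root of its valency. *)
Lemma root_char_poly_adj : (0 < n)%N -> (0 < k)%N -> (0 < l)%N ->
  root (char_poly A) (Num.sqrt (k * l)%:R).
Proof.
move=> n0 k0 l0; rewrite -eigenvalue_root_char; apply/eigenvalueP.
pose f (b : bool) : R := Num.sqrt (if b then k%:R else l%:R).
exists (\row_i f (i \in B)); last first.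
  apply/eqP => /rowP/(_ (Ordinal n0)); rewrite !mxE => /eqP.
  by rewrite gt_eqF // /f sqrtr_gt0; case: ifP; rewrite ltr0n.
apply/rowP => j; rewrite !mxE.
transitivity (\sum_i f (j \notin B) * (e j i)%:R).
  apply: eq_bigr => i _; rewrite !mxE e_sym.
  by case: (boolP (e j i)) => [/e_bip ->|_]; rewrite ?mulr0 // negbK.
rewrite -mulr_sumr -natr_sum -/(valency e j) e_val natrM sqrtrM ?ler0n // /f.
case: (j \in B) => /=.
  by rewrite -{1}(@sqr_sqrtr _ k%:R) ?ler0n // expr2; ring.
by rewrite -{1}(@sqr_sqrtr _ l%:R) ?ler0n // expr2; ring.
Qed.

End BiregularMatrices.

(** * The two trace estimates *)

Section LinearProgramming.
Variables (R : rcfType) (N : nat) (d : 'rV[R]_N) (a p c M : R).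
Local Notation Q := (jacobi a p (a + 1)).
Local Notation S := (jacobi a p a).
Local Notation Psi := (jacobi a p (a + 1 - c)).

(* For the eigenvalues d of A, moment (Q i) (Q j) is the trace of H_i H_j. *)
Definition moment (f g : {poly R}) : R :=
  \sum_r d 0 r ^+ 2 * f.[d 0 r ^+ 2] * g.[d 0 r ^+ 2].

Lemma momentDl f g h : moment (f + g) h = moment f h + moment g h.
Proof. by rewrite -big_split; apply: eq_bigr => r _; rewrite /= hornerD; ring. Qed.

Lemma momentZl x f h : moment (x%:P * f) h = x * moment f h.
Proof. by rewrite mulr_sumr; apply: eq_bigr => r _; rewrite hornerM hornerC; ring. Qed.

Lemma moment_suml m (f : 'I_m -> {poly R}) h :
  moment (\sum_i f i) h = \sum_i moment (f i) h.
Proof.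
rewrite exchange_big; apply: eq_bigr => r _.
by rewrite horner_sum mulr_sumr mulr_suml.
Qed.

Lemma momentC f g : moment f g = moment g f.
Proof. by apply: eq_bigr => r _; ring. Qed.

Hypothesis c_ge0 : 0 <= c.
Hypothesis moment_ge0 : forall i j, 0 <= moment (Q i) (Q j).
Hypothesis moment_diag : forall i, M * p ^+ i <= moment (Q i) (Q i).

(** Here [Psi_{n+1} = Q_{n+1} + c S_n], and [S_j] is the sum of the [Q_i] with [i <= j <= n]. Of all
    the nonnegative products of the [Q_i], only [c] times the diagonal ones are kept. *)
Lemma moment_lower_bound n (w : nat -> R) : (forall i, (i <= n)%N -> 0 <= w i) ->
  c * M * (\sum_(j < n.+1) (w j)%:P * S j).[a + p + 1] <=
  moment (Psi n.+1) (\sum_(j < n.+1) (w j)%:P * S j).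
Proof.
move=> w_ge0; rewrite momentC moment_suml horner_sum mulr_sumr.
apply: ler_sum => j _; rewrite momentZl hornerM hornerC mulrCA.
apply: ler_wpM2l; first by rewrite w_ge0 // -ltnS.
rewrite -(sum_jacobi a p j) moment_suml horner_sum mulr_sumr.
apply: ler_sum => i _; rewrite horner_jacobi_top momentC jacobiB momentDl momentZl.
rewrite -mulrA -[leLHS]add0r lerD // ler_wpM2l // (le_trans (moment_diag i)) //.
have lt_i : (i < n.+1)%N by apply: leq_trans (ltn_ord i) _.
rewrite -(sum_jacobi a p n) moment_suml (bigD1 (Ordinal lt_i)) //= lerDl.
by apply: sumr_ge0.
Qed.

End LinearProgramming.

Lemma count_le1_inj (T : eqType) (P : pred T) (s : seq T) x y :
  (count P s <= 1)%N -> x \in s -> y \in s -> P x -> P y -> x = y.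
Proof.
move=> s1 xs ys Px Py; apply/eqP; apply: contraLR s1 => xy.
rewrite -ltnNge -size_filter.
apply: (@uniq_leq_size _ [:: x; y]); first by rewrite /= inE xy.
by move=> z; rewrite !inE mem_filter => /orP[]/eqP->; rewrite ?Px ?Py.
Qed.

Section SpectralUpperBound.
Variables (R : rcfType) (s : seq R) (K y : R) (q : R -> R).
Hypothesis s_opp : perm_eq s (map -%R s).
Hypothesis s_top : Num.sqrt K \in s.
Hypothesis s_count : (count (fun x => (Num.sqrt y < x)%R) s <= 1)%N.
Hypothesis (K_gt0 : 0 < K) (yK : y < K).

(** A summand is nonpositive unless [|x|] exceeds [sqrt y]. At most one member of [s] exceeds
    [sqrt y], namely [sqrt K], and by symmetry at most one lies below [- sqrt y]: hence the factor
    2. *)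
Lemma sum_upper_bound :
  \sum_(x <- s) x ^+ 2 * ((x ^+ 2 - y) * q (x ^+ 2)) * q (x ^+ 2) <=
  2 * (K * ((K - y) * q K) * q K).
Proof.
set F := fun x : R => x * ((x - y) * q x) * q x.
have FE x : F x = x * (x - y) * q x ^+ 2 by rewrite /F; ring.
have FK : 0 <= F K by rewrite FE mulr_ge0 ?sqr_ge0 ?mulr_ge0 ?subr_ge0 ?ltW.
set t := Num.sqrt y.
have tK : t < Num.sqrt K by rewrite ltr_sqrt.
have top x : x \in s -> t < x -> x = Num.sqrt K.
  by move=> xs tx; apply: (count_le1_inj s_count).
have bottom x : x \in s -> x < - t -> x = - Num.sqrt K.
  move=> xs xt; apply/eqP; rewrite -eqr_oppLR; apply/eqP; apply: top.
    by rewrite (perm_mem s_opp) map_f.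
  by rewrite ltrNr.
have bound x : x \in s -> F (x ^+ 2) <= F K *+ (t < x)%R + F K *+ (x < - t)%R.
  move=> xs; case: (ltP t x) => tx.
    by rewrite (top x xs tx) (sqr_sqrtr (ltW K_gt0)) mulr1n lerDl mulrn_wge0.
  rewrite add0r; case: (ltP x (- t)) => xt.
    by rewrite (bottom x xs xt) sqrrN (sqr_sqrtr (ltW K_gt0)) mulr1n.
  rewrite mulr0n FE mulr_le0_ge0 ?sqr_ge0 //.
  have xt2 : x ^+ 2 <= t ^+ 2.
    by rewrite -real_normK ?num_real // ler_sqr ?nnegrE ?sqrtr_ge0 // ler_norml xt.
  have [y0|y0] := leP 0 y.
    by rewrite mulr_ge0_le0 ?sqr_ge0 // subr_le0 -(sqr_sqrtr y0).
  (* For negative [y] the value of [sqrt y] is 0, which forces [x = 0]. *)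
  have -> : x ^+ 2 = 0; last by rewrite mul0r.
  apply/eqP; rewrite eq_le sqr_ge0 andbT (le_trans xt2) // /t.
  by rewrite ltr0_sqrtr // expr0n.
rewrite big_seq (le_trans (ler_sum _ bound)) // -big_seq big_split /=.
have cnt (P : pred R) : \sum_(x <- s) F K *+ P x = F K *+ count P s.
  by elim: (s) => [|x u IH]; rewrite ?big_nil // big_cons IH /= mulrnDr.
rewrite (cnt (fun x => t < x)) (cnt (fun x => x < - t)) -mulrnDr mulr_natl.
apply: ler_wpMn2l => //.
have -> : count (fun x => x < - t) s = count (fun x => t < x) s.
  rewrite (permP s_opp (fun x => t < x)) count_map.
  by apply: eq_count => x /=; rewrite ltrNr.
by rewrite (leq_add s_count s_count).
Qed.

End SpectralUpperBound.

(** Here [n] is [t - 2], and a vertex must exist for [sqrt (kl)] to be an eigenvalue. The bound is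
    [l Psi(kl) / c] with [Psi(kl)] evaluated. *)
Lemma biregular_bound (R : realType) (N : nat) (e : rel 'I_N) (B : {set 'I_N})
    (k l n : nat) (c : R) :
  (0 < N)%N -> (0 < k)%N -> (0 < l)%N -> 0 < c ->
  symmetric e -> (forall x y, e x y -> (x \in B) = (y \notin B)) ->
  (forall x, valency e x = if x \in B then k else l) ->
  second_eigenvalue (\matrix_(i, j) (e i j)%:R : 'M[R]_N) <=
    second_eigenvalue (Bmx k l n.*2.+3.+2 c) ->
  #|B|%:R <= l%:R * (((k%:R - 1) * (l%:R - 1)) ^+ n.+1 +
    c * \sum_(i < n.+1) ((k%:R - 1) * (l%:R - 1)) ^+ i) / c.
Proof.
move=> N0 k0 l0 c0 e_sym e_bip e_val ev_le.
set p : R := (k%:R - 1) * (l%:R - 1).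
set A : 'M[R]_N := \matrix_(i, j) _ in ev_le.
pose a : R := k%:R + l%:R - 2.
have p0 : 0 <= p by rewrite mulr_ge0 // subr_ge0 ler1n.
have klE : (k * l)%:R = a + p + 1 by rewrite natrM /a /p; ring.
have kl0 : 0 < (k * l)%:R :> R by rewrite ltr0n muln_gt0 k0.
pose Psi := jacobi a p (a + 1 - c).
have [y [y_lt y_root y_ge0 y_gt0]] := jacobi_largest_root a p0 c0 n.
rewrite -klE in y_lt.
have {ev_le} := le_trans ev_le (second_eigenvalue_Bmx_le k0 c0 l0 y_lt y_gt0).
rewrite second_eigenvalue_le ?sqrtr_ge0 // => cnt.
have [d [Ad ANd traces]] := @recursion_spectral _ _ A a p
  (odd_nb_mx R e) (adj_mx_sym R e_sym) (nb_mx0 R e)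
  (nb_mx2 R e_sym e_bip e_val) (fun i => nb_mx_step R e_sym e_bip e_val i.*2).
pose s := [seq d 0 r | r <- enum 'I_N].
have sE : char_poly A = \prod_(x <- s) ('X - x%:P).
  by rewrite Ad big_map big_enum.
have permA := perm_eigenvalues sE.
have s_opp : perm_eq s (map -%R s).
  apply: (@perm_trans _ (eigenvalues A)); first by rewrite perm_sym.
  apply: perm_eigenvalues.
  by rewrite -(char_poly_adjN R e_bip) ANd /s -map_comp big_map big_enum.
have s_top : Num.sqrt (k * l)%:R \in s.
  have := root_char_poly_adj R e_sym e_bip e_val N0 k0 l0.
  by rewrite -/A sE root_prod_XsubC.
rewrite (permP permA) in cnt.
(* This is [Psi / (X - y)] expanded in the [S_j]; its coefficients are nonnegative by [y_ge0]. *)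
pose S := jacobi a p a; pose q := \sum_(j < n.+1) (Psi (n - j)%N).[y]%:P * S j.
have PsiE x : (Psi n.+1).[x] = (x - y) * q.[x].
  have := jacobi_divided_difference a p (a + 1 - c) n x y.
  rewrite (rootP y_root) subr0 => ->; congr (_ * _).
  by rewrite horner_sum; apply: eq_bigr => j _; rewrite hornerM hornerC.
have Psi_kl : 0 < (Psi n.+1).[(k * l)%:R] by apply: y_gt0.
have q_kl : 0 < q.[(k * l)%:R].
  by move: Psi_kl; rewrite PsiE pmulr_rgt0 // subr_gt0.
have upper := sum_upper_bound (horner q) s_opp s_top cnt kl0 y_lt.
have lower : c * (2 * (k%:R * #|B|%:R)) * q.[a + p + 1] <= moment d (Psi n.+1) q.
  apply: moment_lower_bound (ltW c0) _ _ _ (fun i => (Psi (n - i)%N).[y]) _.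
  - by move=> i j; rewrite /moment -traces; apply: odd_nb_mx_trace.
  - move=> i; rewrite /moment -traces.
    exact: (odd_nb_mx_trace_diag R e_sym e_bip e_val i).
  - by move=> i _; apply: y_ge0; rewrite ?lexx // leqW // leq_subr.
have momentE : moment d (Psi n.+1) q =
  \sum_(x <- s) x ^+ 2 * ((x ^+ 2 - y) * q.[x ^+ 2]) * q.[x ^+ 2].
  by rewrite big_map big_enum; apply: eq_bigr => r _; rewrite PsiE.
rewrite momentE in lower; have := le_trans lower upper.
rewrite -PsiE -klE ![_ * q.[_]]mulrC => both.
have Psi_value : (Psi n.+1).[(k * l)%:R] = p ^+ n.+1 + c * \sum_(i < n.+1) p ^+ i.
  rewrite /Psi jacobiB klE hornerD hornerM hornerC horner_jacobi_top -sum_jacobi.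
  rewrite horner_sum; congr (_ + _ * _).
  by apply: eq_bigr => i _; rewrite horner_jacobi_top.
rewrite -Psi_value ler_pdivlMr //.
(* The two estimates share the positive factor [2 k q(kl)], which is cancelled. *)
have k0R : 0 < 2 * k%:R :> R by rewrite mulr_gt0 ?ltr0n.
rewrite -(ler_pM2l k0R) -(ler_pM2l q_kl).
apply: le_trans (le_trans both _); rewrite le_eqVlt; apply/orP; left; apply/eqP.
  by ring.
by rewrite natrM; ring.
Qed.

Lemma card_enum_val (V : finType) (P : pred V) :
  #|[set x | P x]| = (\sum_(i < #|V|) P (enum_val i))%N.
Proof.
rewrite -(big_enum_val (fun x => nat_of_bool (P x))) -sum1dep_card big_mkcond.
by apply: eq_big => // x _; case: (P x).
Qed.

Theorem theorem7p1 (R : realType) (k l t : nat) (c : R)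
    (hk : (0 < k)%N) (hl : (0 < l)%N) (ht : (2 <= t)%N) (hc : 0 < c)
    (V : finType) (e : rel V) (B C : {set V})
    (hG : semiregular_bipartite e B C k l)
    (hev : second_eigenvalue (adjacency_mx R e)
           <= second_eigenvalue (Bmx k l (2 * t + 1) c)) :
  #|B|%:R <=
    l%:R * (\sum_(0 <= i < t.-1) (l%:R - 1) ^+ i * (k%:R - 1) ^+ i)
    + l%:R * (l%:R - 1) ^+ t.-1 * (k%:R - 1) ^+ t.-1 / c.
Proof.
case: hG => e_sym _ cover disj e_bip valB valC.
case: t ht hev => [|[|n]] // _; rewrite (_ : 2 * n.+2 + 1 = n.*2.+3.+2)%N; last by lia.
move=> hev.
have inC x : (x \in C) = (x \notin B).
  have : x \in B :|: C by rewrite cover inE.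
  rewrite inE; case: (boolP (x \in B)) => //= xB _.
  by apply/negbTE; apply: contraL xB => xC; rewrite (disjointFl disj).
pose p : R := (k%:R - 1) * (l%:R - 1).
have -> : l%:R * (\sum_(0 <= i < n.+2.-1) (l%:R - 1) ^+ i * (k%:R - 1) ^+ i)
    + l%:R * (l%:R - 1) ^+ n.+2.-1 * (k%:R - 1) ^+ n.+2.-1 / c =
  l%:R * (p ^+ n.+1 + c * \sum_(i < n.+1) p ^+ i) / c.
  rewrite big_mkord /= (eq_bigr (fun i : 'I_n.+1 => p ^+ i)) => [|i _]; last first.
    by rewrite exprMn mulrC.
  have c0 : c != 0 by rewrite gt_eqF.
  by rewrite /p exprMn; field.
(* Without vertices it is enough that the bound is nonnegative. *)
have [V0|V0] := posnP #|V|.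
  have -> : #|B| = 0%N by apply/eqP; rewrite -leqn0 -V0 max_card.
  have p0 : 0 <= p by rewrite mulr_ge0 // subr_ge0 ler1n.
  clearbody p; apply: divr_ge0 (ltW hc); apply: mulr_ge0 => //.
  by rewrite addr_ge0 ?exprn_ge0 ?mulr_ge0 ?sumr_ge0 ?(ltW hc) // => i _; rewrite exprn_ge0.
pose f (i : 'I_#|V|) : V := enum_val i.
have cardB : #|B| = #|[set i | f i \in B]|.
  rewrite -[LHS](cardsE (mem B)) card_enum_val -sum1dep_card [RHS]big_mkcond.
  by apply: eq_bigr => i _; rewrite /f; case: (_ \in _).
rewrite cardB.
apply: (@biregular_bound R #|V| (fun i j => e (f i) (f j))) => //.
- by move=> i j /e_bip; rewrite inC !inE.
- move=> i; rewrite inE /valency -(card_enum_val (e (f i))).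
  by case: ifP => [/valB //|/negbT]; rewrite -inC => /valC.
Qed.
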